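(* Let $\Gamma$ be a finitely generated group with the rapid decay property RD (respectively, with sub-rapid decay SRD), let $\mu\in\mathrm{Prob}(\Gamma)$ be finitely supported and symmetric, and fix $g\in\Gamma$. If the probability of return to the origin in the $\mu$-random walk on the Schreier graph $\Gamma/C_\Gamma(g)$ decays superpolynomially (respectively, exponentially), then every $\mu$-stationary state $\tau$ on $\mathrm{C}^*_r(\Gamma)$ vanishes at $g$, i.e. $\tau(\lambda_g)=0$.
   Context: Fix a finite symmetric generating set of $\Gamma$; $B_n(\Gamma)$ is the ball of radius $n$ around the identity. $\lambda$ is the left regular representation of $\Gamma$ on $\ell^2(\Gamma)$ (extended linearly to $\mathbb{C}\Gamma$), and $\mathrm{C}^*_r(\Gamma)$ is the reduced C*-algebra. Define $$\rho(n)=\max\left\{\frac{\|\lambda(f)\|}{\|f\|_2}: 0\neq f\in\mathbb{C}\Gamma,\ \mathrm{supp}(f)\subseteq B_n(\Gamma)\right\}.$$ $\Gamma$ has RD if $\rho(n)$ grows polynomially (is bounded above by a polynomial in $n$), and SRD if $\rho(n)$ grows subexponentially ($\limsup_n\rho(n)^{1/n}\le1$). $C_\Gamma(g)$ is the centralizer of $g$. The $\mu$-random walk on $\Gamma/C_\Gamma(g)$ moves from a coset $hC_\Gamma(g)$ to $thC_\Gamma(g)$ with $t$ chosen according to $\mu$; its origin is the trivial coset, so the probability of return to the origin after $n$ steps is $\kappa_n=\mu^{*n}(C_\Gamma(g))$. It decays superpolynomially if $n^k\kappa_n\to0$ for every $k\in\mathbb{N}$, and exponentially if there are $K>0$ and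 $0<r<1$ with $\kappa_n\le Kr^n$ for all $n$. The measure $\mu$ is symmetric if $\mu(t)=\mu(t^{-1})$ for all $t$. A state $\tau$ on $\mathrm{C}^*_r(\Gamma)$ is $\mu$-stationary if $\tau(a)=\sum_{t\in\Gamma}\mu(t)\,\tau(\lambda_t a\lambda_{t^{-1}})$ for all $a\in\mathrm{C}^*_r(\Gamma)$. *)

(* Defs.v *)
From HB Require Import structures.
From mathcomp Require Import all_boot all_order all_algebra.
From mathcomp Require Import complex ring.
From mathcomp Require Import all_classical all_reals all_analysis.

Set Implicit Arguments.
Unset Strict Implicit.
Unset Printing Implicit Defensive.

Import Order.TTheory GRing.Theory Num.Theory.
Import numFieldNormedType.Exports.

Local Open Scope classical_set_scope.
Local Open Scope ring_scope.
Local Open Scope complex_scope.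

Section Groups.
Variable G : groupType.
Implicit Types (S A B : set G) (g t : G).

Definition word_ball S (n : nat) : set G :=
  [set x | exists s : seq G,
     [/\ (size s <= n)%N, (forall y, y \in s -> S y)
       & x = (\prod_(y <- s) y)%g]].

Definition fin_sym_generating S : Prop :=
  [/\ finite_set S, (forall s, S s -> S (s^-1)%g)
    & forall x, exists n, word_ball S n x].

Definition centralizer g : set G := [set x | commute x g].

Definition ltranslate t A : set G := [set (t * x)%g | x in A].

Lemma ltranslateM x t A : ltranslate x (ltranslate t A) = ltranslate (x * t)%g A.
Proof. by rewrite /ltranslate image_comp; apply: eq_imagel => y _ /=; rewrite mulgA. Qed.

Lemma ltranslate1 A : ltranslate 1%g A = A.
Proof. by rewrite /ltranslate -[RHS]image_id; apply: eq_imagel => x _; rewrite mul1g. Qed.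

End Groups.

Section L2.
Variables (R : realType) (G : groupType).
Local Notation C := (R[i]).

Definition normsq (f : G -> C^o) : \bar R :=
  \esum_(x in [set: G]) ((Normc.normc (f x)) ^+ 2)%:E.

Definition sq_summable : {pred (G -> C^o)} := fun f => `[< (normsq f < +oo)%E >].

Lemma normsqZ_lty (c : R) (f : G -> C^o) : 0 <= c -> (normsq f < +oo)%E ->
  (\esum_(x in [set: G]) (c * (Normc.normc (f x)) ^+ 2)%:E < +oo)%E.
Proof.
move=> c0 ff.
have n0 : (0 <= normsq f)%E by apply: esum_ge0 => x _; rewrite lee_fin sqr_ge0.
apply: (@le_lt_trans _ _ (c%:E * normsq f)%E); last by rewrite lte_mul_pinfty.
apply: ge_ereal_sup => _ [A [finA _] <-].
rewrite (eq_fsbigr (fun x => (c%:E * ((Normc.normc (f x)) ^+ 2)%:E)%E)); last first.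
  by move=> x _; rewrite EFinM.
rewrite -ge0_mule_fsumr; last by move=> x; rewrite lee_fin sqr_ge0.
by rewrite lee_wpmul2l ?lee_fin//; apply: ereal_sup_ubound; exists A.
Qed.

Fact sq_summable_submod : submod_closed sq_summable.
Proof.
split.
  apply/asboolP; rewrite /normsq esum1 ?ltry// => x _.
  by rewrite /= expr0n addr0 sqrtr0 expr0n.
move=> a f h /asboolP ff /asboolP fh; apply/asboolP.
pose c := 2 * Normc.normc a ^+ 2.
have nc0 (z : C) : 0 <= Normc.normc z by case: z => x y; exact: sqrtr_ge0.
have c0 : 0 <= c by rewrite mulr_ge0// sqr_ge0.
apply: (@le_lt_trans _ _
  (\esum_(x in [set: G]) ((c * (Normc.normc (f x)) ^+ 2)%:E +
                          (2 * (Normc.normc (h x)) ^+ 2)%:E))%E).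
  apply: le_esum => x _; rewrite -EFinD lee_fin.
  apply: (@le_trans _ _
    ((Normc.normc a * Normc.normc (f x) + Normc.normc (h x)) ^+ 2)).
    rewrite ler_sqr ?nnegrE ?nc0 ?addr_ge0 ?mulr_ge0 ?nc0//.
    by rewrite -Normc.normcM; exact: le_normcD.
  rewrite -subr_ge0 /c.
  set z := Normc.normc a; set u := Normc.normc (f x); set v := Normc.normc (h x).
  by rewrite [leRHS](_ : _ = (z * u - v) ^+ 2) ?sqr_ge0//; ring.
rewrite esumD; [|by move=> x _; rewrite lee_fin mulr_ge0// sqr_ge0..].
by rewrite lte_add_pinfty// normsqZ_lty.
Qed.
HB.instance Definition _ :=
  GRing.isSubmodClosed.Build C (G -> C^o) sq_summable sq_summable_submod.

Record l2 := L2 { l2fun :> G -> C^o; _ : l2fun \in sq_summable }.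
HB.instance Definition _ := [isSub for l2fun].
HB.instance Definition _ := [Choice of l2 by <:].
HB.instance Definition _ := [SubChoice_isSubLmodule of l2 by <:].

Definition l2norm (f : G -> C^o) : R := Num.sqrt (fine (normsq f)).

(* Unconditional sum of a real family; meaningful when [f] is absolutely
   summable, which is the case for the products in [l2inner] below. *)
Definition rsum (f : G -> R) : R :=
  fine (\esum_(x in [set: G]) ((f^\+)%R x)%:E) -
  fine (\esum_(x in [set: G]) ((f^\-)%R x)%:E).

(* Linear in the first argument. *)
Definition l2inner (u v : l2) : C :=
  Complex (rsum (fun x => complex.Re ((u x : C) * (v x : C)^*%C)))
          (rsum (fun x => complex.Im ((u x : C) * (v x : C)^*%C))).

Definition opnorm (a : l2 -> l2) : \bar R :=
  ereal_sup [set (l2norm (a u))%:E | u in [set u : l2 | l2norm u <= 1]].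

Definition bounded_op (a : l2 -> l2) : Prop := linear a /\ (opnorm a < +oo)%E.

Definition adjoint_op (a b : l2 -> l2) : Prop :=
  forall u v : l2, l2inner (a u) v = l2inner u (b v).

Fact lambda_subproof (t : G) (u : l2) :
  (fun x => u (t^-1 * x)%g) \in sq_summable.
Proof.
apply/asboolP; case: u => u /= /asboolP; rewrite /normsq => h.
rewrite -(@reindex_esum R G G [set: G] [set: G] (fun x => (t^-1 * x)%g)
  (fun x => ((Normc.normc (u x)) ^+ 2)%:E))//.
by rewrite setTT_bijective; exists (fun x => (t * x)%g) => x; rewrite ?mulKg ?mulVKg.
Qed.

Definition lambda (t : G) (u : l2) : l2 := L2 (lambda_subproof t u).

Definition group_alg : set (G -> C^o) :=
  [set f | finite_set [set x | f x != 0]].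

Definition lambda_alg (f : G -> C^o) : l2 -> l2 :=
  \sum_(t \in [set: G]) (f t : C) *: lambda t.

(* Operator-norm closure of lambda(C Gamma) in B(l2 Gamma); an operator is
   represented by its underlying function [l2 -> l2]. *)
Definition Cstar_red : set (l2 -> l2) :=
  [set a | bounded_op a /\
     forall e : R, 0 < e -> exists2 f, group_alg f &
       (opnorm (a - lambda_alg f)%R < e%:E)%E].

(* A state: positive linear functional of norm one.  Only the values of [tau] on
   [Cstar_red] are constrained, its values elsewhere being irrelevant. *)
Definition state (tau : (l2 -> l2) -> C) : Prop :=
  [/\ (forall (c : C) a b, Cstar_red a -> Cstar_red b ->
         tau (c *: a + b) = c * tau a + tau b),
      (forall a b, Cstar_red a -> Cstar_red b -> adjoint_op a b ->
         0 <= tau (b \o a))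
    & ereal_sup [set (Normc.normc (tau a))%:E
                | a in Cstar_red `&` [set a | (opnorm a <= 1)%E]] = 1%E].

(* Extended-real supremum: its finiteness (for finite [S]) is not part of the
   definition. *)
Definition rho (S : set G) (n : nat) : \bar R :=
  ereal_sup [set (opnorm (lambda_alg f) * ((l2norm f)^-1)%:E)%E
            | f in [set f | [/\ group_alg f, f != 0
                               & forall x, f x != 0 -> word_ball S n x]]].

Definition RD (S : set G) : Prop :=
  exists p : {poly R}, forall n, (rho S n <= (p.[n%:R])%:E)%E.

Definition SRD (S : set G) : Prop :=
  (limn_esup (fun n => rho S n `^ (n%:R^-1)) <= 1)%E.

Definition fin_prob (mu : G -> R) : Prop :=
  [/\ (forall t, 0 <= mu t), finite_set [set t | mu t != 0]
    & \sum_(t \in [set: G]) mu t = 1].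

Definition symmetric_measure (mu : G -> R) : Prop :=
  forall t, mu t = mu (t^-1)%g.

(* [walk mu n A B] is the probability that the walk A -> t A, with t of law [mu],
   goes from [A] to [B] in exactly n steps.  The vertices of the Schreier graph on
   Gamma / H are the left cosets of H, viewed as subsets of the group. *)
Fixpoint walk (mu : G -> R) (n : nat) (A B : set G) : R :=
  if n is m.+1 then \sum_(t \in [set: G]) mu t * walk mu m (ltranslate t A) B
  else (`[< A = B >])%:R.

Definition return_prob (mu : G -> R) (g : G) (n : nat) : R :=
  walk mu n (centralizer g) (centralizer g).

(* n-fold convolution power; the 0-th one is the Dirac mass at 1. *)
Fixpoint convpow (mu : G -> R) (n : nat) (x : G) : R :=
  if n is m.+1 then \sum_(t \in [set: G]) convpow mu m (x * t^-1)%g * mu t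
  else (x == 1%g)%:R.

Lemma convpow_finite (mu : G -> R) n : finite_set [set t | mu t != 0] ->
  finite_set [set x | convpow mu n x != 0].
Proof.
move=> fmu; elim: n => [|n IH].
  apply: (@sub_finite_set _ _ [set 1%g]) => // x /=.
  by have [->//|_] := eqVneq x 1%g; rewrite eqxx.
apply: (@sub_finite_set _ _ [set (y.1 * y.2)%g | y in
  [set x | convpow mu n x != 0] `*` [set t | mu t != 0]]); last first.
  by apply: finite_image; exact: finite_setX.
move=> x /= /eqP nx; apply: contrapT => nX; apply: nx; apply: fsbig1 => t _.
apply/eqP; rewrite -[_ == _]negbK mulf_eq0 negb_or; apply/negP => /andP[h1 h2].
by apply: nX; exists ((x * t^-1)%g, t) => //=; rewrite mulgVK.
Qed.

Lemma walkE (mu : G -> R) n A B : finite_set [set t | mu t != 0] ->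
  walk mu n A B =
  \sum_(x \in [set: G]) convpow mu n x * (`[< ltranslate x A = B >])%:R.
Proof.
move=> fmu; elim: n A => [|n IH] A /=.
  rewrite (fsbigE [:: 1%g])//=; last first.
    by move=> x _ /=; rewrite inE; case: eqP => //= _ _; rewrite mul0r.
  rewrite big_cons big_nil addr0 eqxx mul1r.
  by rewrite ltranslate1 in_setT.
have fE := convpow_finite n fmu.
set E := [set x | _] in fE; set M := [set t | _] in fmu.
pose X := [set (y.1 * y.2)%g | y in E `*` M].
have fX : finite_set X by apply: finite_image; exact: finite_setX.
transitivity (\sum_(t \in M) \sum_(x \in X)
    mu t * (convpow mu n (x * t^-1)%g * (`[< ltranslate x A = B >])%:R)).
  rewrite -(@fsbig_widen _ _ _ _ M [set: G])//; last first.
    by move=> t [_ /= /negP]; rewrite negbK => /eqP ->; rewrite mul0r.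
  apply: eq_fsbigr => t; rewrite inE => Mt; rewrite -mulr_fsumr IH; congr (_ * _).
  rewrite (reindex_fsbigT (fun x => (x * t^-1)%g)); last first.
    by exists (fun x => (x * t)%g) => x; rewrite ?mulgK ?mulgVK.
  under eq_fsbigr do rewrite ltranslateM mulgVK.
  apply/esym/fsbig_widen => // x [_ /= nX]; apply/eqP; rewrite mulf_eq0.
  apply/orP; left; apply: contrapT => /negP xE; apply: nX.
  by exists ((x * t^-1)%g, t) => //=; rewrite mulgVK.
rewrite exchange_fsbig// (fsbig_widen _ [set: G])//.
  apply: eq_fsbigr => x _; rewrite mulr_fsuml.
  rewrite (fsbig_widen _ [set: G])//; last first.
    by move=> t [_ /= /negP]; rewrite negbK => /eqP ->; rewrite mul0r.
  by apply: eq_fsbigr => t _; rewrite mulrCA mulrA.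
move=> x [_ /= nX]; apply: fsbig1 => t Mt.
have [->|xE] := eqVneq (convpow mu n (x * t^-1)%g) 0; first by rewrite mul0r mulr0.
by exfalso; apply: nX; exists ((x * t^-1)%g, t) => //=; rewrite mulgVK.
Qed.

Lemma return_probE (mu : G -> R) (g : G) (n : nat) :
  finite_set [set t | mu t != 0] ->
  return_prob mu g n = \sum_(x \in centralizer g) convpow mu n x.
Proof.
move=> fmu; rewrite /return_prob walkE// [RHS]fsbig_mkcond.
apply: eq_fsbigr => x _; rewrite patchE.
have -> : (x \in centralizer g) =
    `[< ltranslate x (centralizer g) = centralizer g >].
  apply/idP/asboolP; rewrite inE => h.
    have {}h := commute_sym h; apply/seteqP; split => [_ [y yc <-]|y yc].
      by apply/commute_sym/commuteM => //; exact: commute_sym.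
    exists (x^-1 * y)%g; last by rewrite mulVKg.
    by apply/commute_sym/commuteM; [exact: commuteV|exact: commute_sym].
  by rewrite -h; exists 1%g; rewrite ?mulg1//; exact/commute_sym/commute1.
by case: asboolP => _; rewrite ?mulr1 ?mulr0.
Qed.

Definition superpoly_decay (k : nat -> R) : Prop :=
  forall d : nat, (fun n => n%:R ^+ d * k n) @ \oo --> (0 : R).

Definition exp_decay (k : nat -> R) : Prop :=
  exists K r : R, [/\ 0 < K, 0 < r < 1 & forall n, k n <= K * r ^+ n].

Definition stationary (mu : G -> R) (tau : (l2 -> l2) -> C) : Prop :=
  forall a, Cstar_red a ->
    tau a = \sum_(t \in [set: G])
              (mu t)%:C * tau (lambda t \o a \o lambda (t^-1)%g).

End L2.

(* Main.v *)
Require Import Defs.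
From mathcomp Require Import all_boot all_order all_algebra.
From mathcomp Require Import complex ring lra.
From mathcomp Require Import all_classical all_reals all_analysis.

Set Implicit Arguments.
Unset Strict Implicit.
Unset Printing Implicit Defensive.

Import Order.TTheory GRing.Theory Num.Theory.
Import numFieldNormedType.Exports.

Local Open Scope classical_set_scope.
Local Open Scope ring_scope.
Local Open Scope complex_scope.

(** Let P be the averaging operator (P f)(x) = sum_t mu(t) f(t x t^-1) on
functions on G, and f_n = P^n delta_g: by symmetry of mu, f_n is the law after
n steps of the walk started at g in which each step conjugates by a
mu-distributed element.  P is symmetric for the pairing sum_x f(x) h(x)
([conj_avg_adjoint]), and three facts follow.

- Stationarity says that phi(x) = tau(lambda_x) satisfies P phi = phi, so
  phi(g) = <delta_g, phi> = <f_n, phi> = tau(lambda(f_n)) for every n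
  ([conj_walk_harmonic]).
- The map x C(g) -> x g x^-1 identifies the Schreier graph of G / C(g) with the
  conjugacy class of g, so the return probability kappa_n is f_n(g)
  ([return_prob_conj_walk]).  Hence the squared l2 norm of f_n is
  <P^n delta_g, P^n delta_g> = (P^(2n) delta_g)(g) = kappa_(2n)
  ([conj_walk_inner]).
- If the support of mu lies in the ball of radius L and g in the ball of radius
  l, then f_n lives in the ball of radius 2 n L + l ([conj_walk_ball]).

A state is contractive, so
|tau(lambda_g)|^2 <= ||lambda(f_n)||^2 <= rho(2 n L + l)^2 kappa_(2n)
([stationary_le]).  The right-hand side tends to 0 both when rho is bounded by
a polynomial and kappa decays superpolynomially, and when rho grows
subexponentially and kappa decays exponentially. *)

(** * Averaging over conjugation *)

Lemma fsumT_supp (V : nmodType) (I : choiceType) (A : set I) (F : I -> V) :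
  (forall x, ~ A x -> F x = 0) ->
  \sum_(x \in [set: I]) F x = \sum_(x \in A) F x.
Proof. by move=> F0; apply/esym/fsbig_widen => // x [_ /= /F0]. Qed.

Lemma outside_support (V : nmodType) (I : Type) (f : I -> V) x :
  ~ [set x | f x != 0] x -> f x = 0.
Proof. by move/negP; rewrite negbK => /eqP. Qed.

Lemma conjVK (G : groupType) (t x : G) : (t^-1 * (t * x * t^-1) * t)%g = x.
Proof. by rewrite !mulgA mulVg mul1g mulgVK. Qed.

Lemma conjK (G : groupType) (t x : G) : (t * (t^-1 * x * t) * t^-1)%g = x.
Proof. by rewrite !mulgA mulgV mul1g mulgK. Qed.

Section ConjAverage.
Variables (K : idomainType) (G : groupType).
Implicit Types (m f h : G -> K).

Definition conj_avg m f (x : G) : K :=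
  \sum_(t \in [set: G]) m t * f (t * x * t^-1)%g.

Lemma finite_supp_conj m f : finite_set [set x | f x != 0] ->
  finite_set [set t | m t != 0] ->
  finite_set [set (y.2^-1 * y.1 * y.2)%g | y in
    [set x | f x != 0] `*` [set t | m t != 0]].
Proof. by move=> ff fm; apply: finite_image; exact: finite_setX. Qed.

Lemma conj_avg_finite m f : finite_set [set t | m t != 0] ->
  finite_set [set x | f x != 0] -> finite_set [set x | conj_avg m f x != 0].
Proof.
move=> fm ff; apply: sub_finite_set (finite_supp_conj ff fm) => x /= nx.
apply: contrapT => nX; move/eqP: nx; apply; apply: fsbig1 => t _.
have [->|mt] := eqVneq (m t) 0; first by rewrite mul0r.
have [->|fx] := eqVneq (f (t * x * t^-1)%g) 0; first by rewrite mulr0.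
by exfalso; apply: nX; exists ((t * x * t^-1)%g, t) => //=; exact: conjVK.
Qed.

(** For fixed t, substituting x := t^-1 x t moves the conjugation from f to h and
inverts t; the symmetry of m absorbs the inversion.  The function h is arbitrary
because the lemma is applied to x |-> tau(lambda_x). *)
Lemma conj_avg_adjoint m f h : finite_set [set t | m t != 0] ->
  (forall t, m t = m t^-1%g) -> finite_set [set x | f x != 0] ->
  \sum_(x \in [set: G]) conj_avg m f x * h x =
  \sum_(x \in [set: G]) f x * conj_avg m h x.
Proof.
move=> fm sm ff.
have fX := finite_supp_conj ff fm.
set F := [set x | f x != 0] in ff fX; set M := [set t | m t != 0] in fm fX.
set X := image _ _ in fX.
have m0 t : ~ M t -> m t = 0 by exact: outside_support.
have f0 x : ~ F x -> f x = 0 by exact: outside_support.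
have fX0 x t : ~ X x -> M t -> f (t * x * t^-1)%g = 0.
  move=> nX Mt; apply: f0 => Fx; apply: nX.
  by exists ((t * x * t^-1)%g, t) => //=; exact: conjVK.
have avgE u x : conj_avg m u x = \sum_(t \in M) m t * u (t * x * t^-1)%g.
  by apply: fsumT_supp => t /m0 ->; rewrite mul0r.
transitivity (\sum_(x \in X) \sum_(t \in M) (m t * f (t * x * t^-1)%g) * h x).
  (* Outside X every conjugate by an element of M leaves the support of f. *)
  rewrite (@fsumT_supp _ _ X); last first.
    move=> x nX; rewrite avgE fsbig1 ?mul0r// => t Mt.
    by rewrite (fX0 _ _ nX Mt) mulr0.
  by apply: eq_fsbigr => x _; rewrite avgE mulr_fsuml.
rewrite exchange_fsbig//.
transitivity (\sum_(t \in M) \sum_(x \in F) m t * f x * h (t^-1 * x * t)%g).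
  apply: eq_fsbigr => t; rewrite inE => Mt.
  rewrite -(@fsumT_supp _ _ X); last by move=> x /fX0/(_ Mt) ->; rewrite mulr0 mul0r.
  rewrite -(@fsumT_supp _ _ F); last by move=> x /f0 ->; rewrite mulr0 mul0r.
  rewrite [RHS](@reindex_fsbigT _ _ _ _ _ (fun x => t * x * t^-1)%g).
    by apply: eq_fsbigr => x _; rewrite conjVK.
  by exists (fun x => t^-1 * x * t)%g => x; [exact: conjVK|exact: conjK].
rewrite exchange_fsbig// [RHS](@fsumT_supp _ _ F); last first.
  by move=> x /f0 ->; rewrite mul0r.
apply: eq_fsbigr => x _; rewrite /conj_avg mulr_fsumr.
rewrite -(@fsumT_supp _ _ M); last by move=> t /m0 ->; rewrite !mul0r.
rewrite (@reindex_fsbigT _ _ _ _ _ (fun t => t^-1)%g); last first.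
  by exists (fun t => t^-1)%g => t; rewrite invgK.
by apply: eq_fsbigr => t _; rewrite -sm invgK mulrCA mulrA.
Qed.

End ConjAverage.

(** * The walk on the conjugacy class of g *)

Section ConjWalk.
Variables (K : idomainType) (G : groupType) (m : G -> K) (g : G).
Hypothesis fm : finite_set [set t | m t != 0].
Hypothesis sm : forall t, m t = m t^-1%g.

Definition conj_walk n : G -> K := iter n (conj_avg m) (fun x => (x == g)%:R).

Lemma conj_walk0 x : conj_walk 0 x = (x == g)%:R.
Proof. by []. Qed.

Lemma conj_walkS n x : conj_walk n.+1 x = conj_avg m (conj_walk n) x.
Proof. by []. Qed.

Lemma conj_walk_finite n : finite_set [set x | conj_walk n x != 0].
Proof.
elim: n => [|n IH]; last exact: conj_avg_finite.
apply: (@sub_finite_set _ _ [set g]) => // x /=.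
by have [->//|_] := eqVneq x g; rewrite eqxx.
Qed.

(** Optional stopping at a fixed time: a harmonic function keeps its mean along
the walk.  Algebraically, <P^n delta_g, h> = <delta_g, P^n h>. *)
Lemma conj_walk_harmonic (h : G -> K) n : (forall x, h x = conj_avg m h x) ->
  \sum_(x \in [set: G]) conj_walk n x * h x = h g.
Proof.
move=> hh; elim: n => [|n IH].
  rewrite (@fsumT_supp _ _ [set g]) ?fsbig_set1 ?conj_walk0 ?eqxx ?mul1r//.
  by move=> x /eqP/negPf; rewrite conj_walk0 => ->; rewrite mul0r.
rewrite -IH; under eq_fsbigr do rewrite conj_walkS.
rewrite conj_avg_adjoint//; last exact: conj_walk_finite.
by apply: eq_fsbigr => x _; rewrite -hh.
Qed.

(** Moving the powers of P from one side of the pairing to the other.  For a = b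
the left-hand side is a squared l2 norm and the right-hand side a return
probability. *)
Lemma conj_walk_inner a b :
  \sum_(x \in [set: G]) conj_walk a x * conj_walk b x = conj_walk (a + b) g.
Proof.
elim: a b => [|a IH] b.
  rewrite (@fsumT_supp _ _ [set g]) ?fsbig_set1 ?conj_walk0 ?eqxx ?mul1r//.
  by move=> x /eqP/negPf; rewrite conj_walk0 => ->; rewrite mul0r.
rewrite addSnnS -IH; under eq_fsbigr do rewrite conj_walkS.
by rewrite conj_avg_adjoint//; exact: conj_walk_finite.
Qed.

End ConjWalk.

(** The walk is used both with real values, for norms and return probabilities,
and with complex values, as an element of the group algebra. *)
Lemma conj_walk_morph (K L : idomainType) (c : {rmorphism K -> L}) (G : groupType)
  (m : G -> K) (g : G) n x : finite_set [set t | m t != 0] ->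
  conj_walk (c \o m) g n x = c (conj_walk m g n x).
Proof.
move=> fm; elim: n x => [|n IH] x; first by rewrite !conj_walk0 rmorph_nat.
rewrite !conj_walkS /conj_avg.
rewrite (@fsumT_supp _ _ [set t | m t != 0]); last first.
  by move=> t nt; rewrite /= (outside_support nt) rmorph0 mul0r.
rewrite (@fsumT_supp _ _ [set t | m t != 0]); last first.
  by move=> t nt; rewrite (outside_support nt) mul0r.
rewrite !fsbig_finite// rmorph_sum; apply: eq_bigr => t _.
by rewrite rmorphM IH.
Qed.

Lemma ltranslate_centralizer (G : groupType) (g x : G) :
  (ltranslate x (centralizer g) = centralizer g) <-> (x * g * x^-1 = g)%g.
Proof.
split=> [h|xg].
  have : centralizer g x.
    by rewrite -h; exists 1%g; rewrite ?mulg1//; exact/commute_sym/commute1.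
  by rewrite /centralizer/= /commute => ->; rewrite mulgK.
have xC : commute x g by rewrite /commute -{2}xg mulgVK.
apply/seteqP; split => [_ [y yc <-]|y yc].
  by apply/commute_sym/commuteM; exact: commute_sym.
exists (x^-1 * y)%g; last by rewrite mulVKg.
by apply/commute_sym/commuteM; [exact/commuteV/commute_sym|exact: commute_sym].
Qed.

(** The coset of x corresponds to the conjugate x g x^-1, and the step
x C(g) -> t x C(g) to conjugation by t. *)
Lemma walk_conj_walk (R : realType) (G : groupType) (mu : G -> R) (g : G) n x :
  walk mu n (ltranslate x (centralizer g)) (centralizer g) =
  conj_walk mu g n (x * g * x^-1)%g.
Proof.
elim: n x => [|n IH] x.
  rewrite conj_walk0/=; congr (_%:R).
  by apply: congr1; apply/asboolP/eqP => /ltranslate_centralizer.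
rewrite conj_walkS/=; apply: eq_fsbigr => t _.
by rewrite ltranslateM IH invgM !mulgA.
Qed.

Lemma return_prob_conj_walk (R : realType) (G : groupType) (mu : G -> R) (g : G) n :
  return_prob mu g n = conj_walk mu g n g.
Proof.
by rewrite /return_prob -{1}[centralizer g]ltranslate1 walk_conj_walk mul1g invg1 mulg1.
Qed.

(** * Supports and word balls *)

Section WordBalls.
Variables (G : groupType) (S : set G).

Lemma word_ballM a b x y : word_ball S a x -> word_ball S b y ->
  word_ball S (a + b) (x * y)%g.
Proof.
move=> [s [sa sS ->]] [r [rb rS ->]]; exists (s ++ r); split.
- by rewrite size_cat leq_add.
- by move=> z; rewrite mem_cat => /orP[/sS|/rS].
- by rewrite big_cat.
Qed.

Lemma word_ballW a b x : (a <= b)%N -> word_ball S a x -> word_ball S b x.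
Proof. by move=> ab [s [sa sS ->]]; exists s; split=> //; exact: leq_trans ab. Qed.

Lemma finite_in_ball (A : set G) : (forall x, exists n, word_ball S n x) ->
  finite_set A -> exists n, A `<=` word_ball S n.
Proof.
move=> gen fA.
have [k kP] := choice gen.
exists (\max_(x <- finmap.enum_fset (fset_set A)) k x)%N => x Ax.
apply: word_ballW (kP x); apply: leq_bigmax_seq => //.
by rewrite in_fset_set// inE.
Qed.

(** One step of the walk multiplies by an element of the support of m on one side
and by its inverse, which is also in the support, on the other: the radius
grows by 2 L. *)
Lemma conj_walk_ball (K : idomainType) (m : G -> K) (g : G) L l n x :
  (forall t, m t = m t^-1%g) ->
  [set t | m t != 0] `<=` word_ball S L -> word_ball S l g ->
  conj_walk m g n x != 0 -> word_ball S (L * n.*2 + l) x.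
Proof.
move=> sm mL gl; elim: n x => [|n IH] x.
  by rewrite conj_walk0 muln0; have [->//|_] := eqVneq x g; rewrite eqxx.
rewrite conj_walkS => nx.
have [t [mt wt]] : exists t, m t != 0 /\ conj_walk m g n (t * x * t^-1)%g != 0.
  apply: contrapT => no; move/eqP: nx; apply; apply: fsbig1 => t _.
  apply/eqP; rewrite mulf_eq0; apply: contrapT => /negP; rewrite negb_or => /andP[? ?].
  by apply: no; exists t.
rewrite -(conjVK t x).
have -> : (L * n.+1.*2 + l = L + (L * n.*2 + l) + L)%N.
  by rewrite doubleS !mulnS; ring.
apply: word_ballM (mL _ mt); apply: word_ballM (IH _ wt).
by apply: mL; rewrite /= -sm.
Qed.

End WordBalls.

(** * Operators of the group algebra on l2 *)

Section L2Bounds.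
Variables (R : realType) (G : groupType).
Local Notation C := R[i].
Implicit Types (u v : l2 R G) (f h : G -> C^o).

Lemma normc_ge0 (z : C) : 0 <= Normc.normc z.
Proof. by case: z => x y; exact: sqrtr_ge0. Qed.

Lemma normsq_ge0 f : (0 <= normsq f)%E.
Proof. by apply: esum_ge0 => x _; rewrite lee_fin sqr_ge0. Qed.

Lemma normsq_l2_fin u : normsq u \is a fin_num.
Proof.
by rewrite ge0_fin_numE ?normsq_ge0//; case: u => u /= /asboolP.
Qed.

Lemma ge0_esumZl_le (c : R) (a : G -> R) : 0 <= c -> (forall x, 0 <= a x) ->
  (\esum_(x in [set: G]) (c * a x)%:E <=
   c%:E * \esum_(x in [set: G]) (a x)%:E)%E.
Proof.
move=> c0 a0; apply: ge_ereal_sup => _ [A [finA _] <-].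
rewrite (eq_fsbigr (fun x => (c%:E * (a x)%:E)%E)); last by move=> x _; rewrite EFinM.
rewrite -ge0_mule_fsumr; last by move=> x; rewrite lee_fin.
by rewrite lee_wpmul2l ?lee_fin//; apply: ereal_sup_ubound; exists A.
Qed.

Lemma normsqZ_le (c : C) f :
  (normsq (c *: f) <= (Normc.normc c ^+ 2)%:E * normsq f)%E.
Proof.
apply: le_trans (ge0_esumZl_le _ _) => [||x]; try exact: sqr_ge0.
by apply: le_esum => x _; rewrite lee_fin Normc.normcM exprMn.
Qed.

(** From (a + b)^2 <= 2 a^2 + 2 b^2.  This loses a factor 2 against the triangle
inequality, but it is enough to prove that the operators lambda(f) are
bounded. *)
Lemma normsqD_le f h : (normsq (f + h)%R <= 2%:E * normsq f + 2%:E * normsq h)%E.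
Proof.
apply: (@le_trans _ _ (\esum_(x in [set: G]) ((2 * Normc.normc (f x) ^+ 2)%:E +
                         (2 * Normc.normc (h x) ^+ 2)%:E))%E).
  apply: le_esum => x _; rewrite -EFinD lee_fin.
  apply: (@le_trans _ _ ((Normc.normc (f x) + Normc.normc (h x)) ^+ 2)).
    by rewrite ler_sqr ?nnegrE ?addr_ge0 ?normc_ge0//; exact: le_normcD.
  have := sqr_ge0 (Normc.normc (f x) - Normc.normc (h x)); nra.
rewrite esumD; [|by move=> x _; rewrite lee_fin mulr_ge0// sqr_ge0..].
by apply: leeD; apply: ge0_esumZl_le => // x; exact: sqr_ge0.
Qed.

Lemma normsq_lambda t u : normsq (lambda t u) = normsq u.
Proof.
rewrite /normsq [RHS](@reindex_esum R G G [set: G] [set: G] (fun x => (t^-1 * x)%g))//.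
by rewrite setTT_bijective; exists (fun x => (t * x)%g) => x; rewrite ?mulKg ?mulVKg.
Qed.

Lemma l2normZ_le (c : C) u : l2norm (c *: u) <= Normc.normc c * l2norm u.
Proof.
rewrite /l2norm -[X in X * _]ger0_norm ?normc_ge0// -sqrtr_sqr -sqrtrM ?sqr_ge0//.
rewrite ler_wsqrtr// -lee_fin EFinM !fineK ?normsq_l2_fin//.
exact: normsqZ_le.
Qed.

Lemma normsq_finite_supp (f : G -> C^o) : finite_set [set x | f x != 0] ->
  normsq f = (\sum_(x \in [set: G]) Normc.normc (f x) ^+ 2)%:E.
Proof.
move=> ff; have f0 x : ~ [set x | f x != 0] x -> Normc.normc (f x) ^+ 2 = 0.
  by move=> nx; rewrite (outside_support nx) Normc.normc0 expr0n.
rewrite (fsumT_supp f0).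
rewrite -fsumEFin// -esum_fset//; last by move=> x _; rewrite lee_fin sqr_ge0.
rewrite [RHS]esum_mkcond; apply: eq_esum => x _.
by case: ifPn => //; rewrite notin_setE => /f0 ->.
Qed.

Lemma normsq0 : normsq (0 : l2 R G) = 0%E.
Proof. by rewrite /normsq esum1// => x _; rewrite Normc.normc0 expr0n. Qed.

Lemma bounded_op_normsq (a : l2 R G -> l2 R G) (k : R) : linear a ->
  (forall u, (normsq (a u) <= k%:E * normsq u)%E) -> bounded_op a.
Proof.
move=> la ak; split=> //; apply: (@le_lt_trans _ _ (Num.sqrt `|k|)%:E); last exact: ltry.
apply: ge_ereal_sup => _ [u /= u1 <-]; rewrite lee_fin ler_wsqrtr//.
have {}u1 : fine (normsq u) <= 1.
  by rewrite -ler_sqrt ?ltr01// sqrtr1.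
rewrite -lee_fin fineK ?normsq_l2_fin//; apply: le_trans (ak u) _.
rewrite -(fineK (normsq_l2_fin u)) -EFinM lee_fin.
apply: le_trans (ler_wpM2r _ (ler_norm k)) _; first exact/fine_ge0/normsq_ge0.
by rewrite ler_piMr.
Qed.

Lemma lambda_linear t : linear (@lambda R G t).
Proof. by move=> c u v; apply/val_inj/funext => x. Qed.

Lemma bounded_lambda_sum (s : seq G) (c : G -> C) :
  bounded_op (\sum_(t <- s) c t *: @lambda R G t).
Proof.
suff [la [k [k0 ak]]] : linear (\sum_(t <- s) c t *: @lambda R G t) /\
    exists k : R, 0 <= k /\ forall u,
      (normsq ((\sum_(t <- s) c t *: @lambda R G t)%R u) <= k%:E * normsq u)%E.
  exact: bounded_op_normsq ak.
elim: s => [|t s [la [k [k0 ak]]]].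
  rewrite big_nil; split; first by move=> z u v; rewrite /= scaler0 addr0.
  by exists 0; split=> // u; rewrite mul0e -[leLHS]/(normsq (0 : l2 R G)) normsq0.
rewrite big_cons; set a := \sum_(t <- s) _ in la ak *; split.
  move=> z u v; have -> x : (c t *: lambda t + a) x = c t *: lambda t x + a x by [].
  rewrite la lambda_linear !scalerDr !scalerA [c t * z]mulrC -!addrA.
  by congr (_ + _); rewrite addrCA.
exists (2 * Normc.normc (c t) ^+ 2 + 2 * k); split.
  by apply: addr_ge0; apply: mulr_ge0 => //; exact: sqr_ge0.
have n1 : 0 <= 2 * Normc.normc (c t) ^+ 2 by rewrite mulr_ge0 ?sqr_ge0.
have n2 : 0 <= 2 * k by rewrite mulr_ge0.
move=> u; apply: le_trans (normsqD_le _ _) _.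
rewrite [X in (_ <= X * _)%E]EFinD ge0_muleDl ?lee_fin//.
rewrite [X in (_ <= X * _ + _)%E]EFinM [X in (_ <= _ + X * _)%E]EFinM -!muleA.
apply: leeD; rewrite lee_pmul2l//.
by apply: le_trans (normsqZ_le _ _) _; rewrite normsq_lambda.
exact: ak.
Qed.

Lemma lambda_algE f : group_alg f ->
  lambda_alg f = \sum_(t <- finmap.enum_fset (fset_set [set x | f x != 0]))
    (f t : C) *: lambda t.
Proof.
move=> ff; rewrite /lambda_alg (@fsumT_supp _ _ [set x | f x != 0]) ?fsbig_finite//.
by move=> x nx; rewrite (outside_support nx) scale0r.
Qed.

Lemma Cstar_lambda_alg f : group_alg f -> Cstar_red (lambda_alg f).
Proof.
move=> ff; split; first by rewrite lambda_algE//; exact: bounded_lambda_sum.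
move=> e e0; exists f => //; apply: le_lt_trans (_ : (0 < _)%E); last by rewrite lte_fin.
apply: ge_ereal_sup => _ [u _ <-]; rewrite subrr lee_fin.
by rewrite -[leLHS]/(l2norm (0 : l2 R G)) /l2norm normsq0 sqrtr0.
Qed.

Lemma Cstar_lambda_sum (s : seq G) (c : G -> C) : uniq s ->
  Cstar_red (\sum_(t <- s) c t *: @lambda R G t).
Proof.
move=> us; pose f : G -> C^o := fun t => if t \in s then c t else 0.
have f0 t : ~ [set` s] t -> f t = 0 by rewrite /f /= => /negP/negPf ->.
suff -> : \sum_(t <- s) c t *: lambda t = lambda_alg f.
  apply: Cstar_lambda_alg; apply: sub_finite_set (finite_seq s) => t /=.
  by rewrite /f; case: ifPn => //; rewrite eqxx.
rewrite /lambda_alg (@fsumT_supp _ _ [set` s]); last by move=> t /f0 ->; rewrite scale0r.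
by rewrite fsbig_seq//; apply: eq_fsbigr => t; rewrite inE /f /= => ->.
Qed.

Lemma Cstar_lambda t : Cstar_red (@lambda R G t).
Proof.
have := @Cstar_lambda_sum [:: t] (fun=> 1) isT.
by rewrite big_seq1 scale1r.
Qed.

Lemma lambda_conj t x : @lambda R G t \o lambda x \o lambda t^-1%g =
  lambda (t * x * t^-1)%g.
Proof.
apply/funext => u; apply/val_inj/funext => y /=.
by rewrite !invgM !invgK !mulgA.
Qed.

End L2Bounds.

(** * States on the reduced algebra *)

Section States.
Variables (R : realType) (G : groupType) (tau : (l2 R G -> l2 R G) -> R[i]).
Local Notation C := R[i].
Hypothesis st : state tau.

(** A state is linear only on the reduced algebra, so each partial sum has to be
seen there; duplicate-free lists make it the image of a function on the
group. *)
Lemma state_lambda_sum (s : seq G) (c : G -> C) : uniq s ->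
  tau (\sum_(t <- s) c t *: lambda t) = \sum_(t <- s) c t * tau (lambda t).
Proof.
have [lin _ _] := st.
elim: s => [|t s IH] /=.
  move=> _; rewrite !big_nil.
  have := @Cstar_lambda_sum R G [::] (fun=> 0) isT; rewrite big_nil => C0.
  have /eqP := lin (-1) 0 0 C0 C0.
  by rewrite scaler0 addr0 mulN1r addNr => /eqP.
move=> /andP[ts us]; rewrite !big_cons lin ?IH//.
  exact: Cstar_lambda.
exact: Cstar_lambda_sum.
Qed.

Lemma state_lambda_alg (f : G -> C^o) : group_alg f ->
  tau (lambda_alg f) = \sum_(t \in [set: G]) (f t : C) * tau (lambda t).
Proof.
move=> ff; rewrite lambda_algE// state_lambda_sum ?finmap.fset_uniq//.
rewrite (@fsumT_supp _ _ [set x | f x != 0]) ?fsbig_finite//.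
by move=> x nx; rewrite (outside_support nx) mul0r.
Qed.

Lemma state_opnorm_le1 a : Cstar_red a -> (opnorm a <= 1)%E ->
  Normc.normc (tau a) <= 1.
Proof.
move=> Ca a1; have [_ _ st1] := st.
by rewrite -lee_fin -st1; apply: ereal_sup_ubound; exists a.
Qed.

(** A state has norm one on the unit ball of the reduced algebra; the general case
follows by rescaling lambda(f) by 1 / M. *)
Lemma state_lambda_alg_le (f : G -> C^o) (M : R) : group_alg f -> 0 < M ->
  (opnorm (lambda_alg f) <= M%:E)%E ->
  Normc.normc (\sum_(t \in [set: G]) (f t : C) * tau (lambda t)) <= M.
Proof.
move=> ff M0 fM.
have nM : Normc.normc (M^-1)%:C = M^-1.
  by rewrite /= expr0n addr0 sqrtr_sqr ger0_norm// invr_ge0 ltW.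
pose s := finmap.enum_fset (fset_set [set x | f x != 0]).
have us : uniq s by exact: finmap.fset_uniq.
have sE : (M^-1)%:C *: lambda_alg f = \sum_(t <- s) ((M^-1)%:C * f t) *: lambda t.
  by rewrite lambda_algE// scaler_sumr; apply: eq_bigr => t _; rewrite scalerA.
have : Normc.normc (tau ((M^-1)%:C *: lambda_alg f)) <= 1.
  apply: state_opnorm_le1; first by rewrite sE; exact: Cstar_lambda_sum.
  apply: ge_ereal_sup => _ [u u1 <-]; rewrite lee_fin.
  apply: le_trans (l2normZ_le _ _) _; rewrite nM mulrC ler_pdivrMr// mul1r -lee_fin.
  by apply: le_trans fM; apply: ereal_sup_ubound; exists u.
rewrite sE state_lambda_sum//.
under eq_bigr do rewrite -mulrA.
rewrite -mulr_sumr -state_lambda_sum// /s -lambda_algE// state_lambda_alg//.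
by rewrite Normc.normcM nM mulrC ler_pdivrMr// mul1r.
Qed.

Lemma state_le_rho (S : set G) (f : G -> C^o) (n : nat) (M : R) : group_alg f ->
  (forall x, f x != 0 -> word_ball S n x) -> (rho R S n <= M%:E)%E -> 0 < M ->
  Normc.normc (\sum_(t \in [set: G]) (f t : C) * tau (lambda t)) ^+ 2 <=
  M ^+ 2 * fine (normsq f).
Proof.
move=> ff fS rM M0; have nf0 := fine_ge0 (normsq_ge0 f).
(* The supremum defining rho ranges over nonzero f. *)
have [f0|f0] := eqVneq f 0.
  rewrite fsbig1; last by move=> x _; rewrite f0 mul0r.
  by rewrite Normc.normc0 expr0n /=; apply: mulr_ge0 => //; exact: sqr_ge0.
have lf0 : 0 < l2norm f.
  rewrite sqrtr_gt0 lt_neqAle nf0 andbT eq_sym; apply: contra_neq f0 => nf.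
  move: nf; rewrite normsq_finite_supp//= => nf; apply/funext => x.
  have [//|fx] := eqVneq (f x) 0.
  apply: Normc.eq0_normc; apply/eqP; rewrite -sqrf_eq0.
  move/eqP: nf; rewrite (@fsumT_supp _ _ [set x | f x != 0]); last first.
    by move=> y ny; rewrite (outside_support ny) Normc.normc0 expr0n.
  rewrite fsbig_finite// psumr_eq0; last by move=> *; exact: sqr_ge0.
  by move=> /allP/(_ x); rewrite in_fset_set// inE => /(_ fx).
have : (opnorm (lambda_alg f) <= (M * l2norm f)%:E)%E.
  rewrite EFinM -lee_pdivrMr//; apply: le_trans rM; apply: ereal_sup_ubound.
  by exists f.
move=> /(state_lambda_alg_le ff (mulr_gt0 M0 lf0)) h.
rewrite -[X in _ * X]sqr_sqrtr// -exprMn ler_sqr ?nnegrE ?normc_ge0//.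
by rewrite mulr_ge0 ?ltW.
Qed.

End States.

(** * The bound on stationary states *)

Section Stationary.
Variables (R : realType) (G : groupType) (S : set G) (mu : G -> R) (g : G).
Variable tau : (l2 R G -> l2 R G) -> R[i].
Hypotheses (fm : finite_set [set t | mu t != 0]) (sm : symmetric_measure mu).
Hypotheses (st : state tau) (stat : stationary mu tau).

(** tau(lambda_g) equals tau(lambda(f_n)) by harmonicity of x |-> tau(lambda_x),
and the operator norm of lambda(f_n) is at most rho times the l2 norm of f_n,
whose square is the return probability at time 2n. *)
Lemma stationary_le (L l n : nat) (M : R) :
  [set t | mu t != 0] `<=` word_ball S L -> word_ball S l g ->
  (rho R S (L * n.*2 + l) <= M%:E)%E -> 0 < M ->
  Normc.normc (tau (lambda g)) ^+ 2 <= M ^+ 2 * return_prob mu g n.*2.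
Proof.
move=> mL gl rM M0.
pose f : G -> R[i]^o := fun x => (conj_walk mu g n x)%:C.
have f0 x : (f x != 0) = (conj_walk mu g n x != 0).
  by rewrite /f -(inj_eq (@complexI R)).
have ff : group_alg f.
  by apply: sub_finite_set (conj_walk_finite g fm n) => x /=; rewrite f0.
have -> : tau (lambda g) = \sum_(t \in [set: G]) (f t : R[i]) * tau (lambda t).
  pose h (x : G) : R[i] := tau (lambda x); rewrite -[LHS]/(h g).
  rewrite -(@conj_walk_harmonic _ _ (real_complex R \o mu) g _ _ h n).
  - by apply: eq_fsbigr => x _; rewrite conj_walk_morph.
  - apply: sub_finite_set fm => t /=.
    by rewrite -[0]/(real_complex R 0) (inj_eq (@complexI R)).
  - by move=> t /=; rewrite sm.
  - move=> x; rewrite /h stat; last exact: Cstar_lambda.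
    by apply: eq_fsbigr => t _; rewrite lambda_conj.
have -> : return_prob mu g n.*2 = fine (normsq f).
  rewrite return_prob_conj_walk -addnn -conj_walk_inner// normsq_finite_supp//=.
  apply: eq_fsbigr => x _.
  by rewrite /f /= expr0n addr0 sqrtr_sqr -normrX ger0_norm ?sqr_ge0.
apply: state_le_rho rM M0 => // x; rewrite f0; exact: conj_walk_ball.
Qed.

End Stationary.

(** * Growth against decay *)

Section Asymptotics.
Variable R : realType.

Lemma superpoly_decay_horner (k : nat -> R) (q : {poly R}) : superpoly_decay k ->
  (fun n => q.[n%:R] * k n) @ \oo --> (0 : R).
Proof.
elim/poly_ind: q k => [|p c IH] k kd.
  rewrite (_ : (fun _ => _) = fun=> 0); first exact: cvg_cst.
  by apply/funext => n; rewrite horner0 mul0r.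
have -> : (fun n => (p * 'X + c%:P).[n%:R] * k n) =
    (fun n => p.[n%:R] * (n%:R * k n) + c * k n).
  by apply/funext => n; rewrite hornerMXaddC; ring.
rewrite -[X in _ --> X]addr0; apply: cvgD.
  apply: IH => d.
  rewrite (_ : (fun _ => _) = fun n => n%:R ^+ d.+1 * k n); first exact: kd.
  by apply/funext => n; rewrite mulrA -exprSr.
have k0 : k @ \oo --> (0 : R).
  rewrite (_ : k = fun n => n%:R ^+ 0 * k n); first exact: kd.
  by apply/funext => n; rewrite expr0 mul1r.
by rewrite -[X in _ --> X](mulr0 c); exact: cvgMl_tmp.
Qed.

(** The bound on tau(lambda_g) involves return probabilities at even times only. *)
Lemma le0_of_cvg0 (c : R) (a : nat -> R) : a @ \oo --> (0 : R) ->
  (\forall n \near \oo, c <= a n.*2) -> c <= 0.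
Proof.
move=> a0 [N _ cN]; rewrite leNgt; apply/negP => c0.
have [N' _ aN'] := cvgr_lt _ a0 _ c0.
have := cN (N + N')%N (leq_addr _ _).
rewrite leNgt => /negP; apply; apply: aN' => /=.
by rewrite -addnn (leq_trans (leq_addl N N'))// leq_addr.
Qed.

Lemma SRD_rho_le (G : groupType) (S : set G) (s : R) : SRD R S -> 1 < s ->
  \forall n \near \oo, (rho R S n <= (s ^+ n)%:E)%E.
Proof.
move=> srd s1.
have : (limn_esup (fun n => rho R S n `^ (n%:R^-1)) < s%:E)%E.
  by apply: le_lt_trans srd _; rewrite lte_fin.
move=> /ereal_inf_lt[_ [V [N _ NV] <-] Vs].
exists N.+1 => // n /= Nn.
have n0 : (n%:R : R) != 0 by rewrite pnatr_eq0 -lt0n (leq_trans _ Nn).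
(* rho = (rho^(1/n))^n holds for nonnegative values only. *)
have [r0|r0] := leP 0%E (rho R S n); last first.
  by apply: le_trans (ltW r0) _; rewrite lee_fin exprn_ge0// ltW// (lt_trans _ s1).
rewrite -[leLHS]poweRe1// -(mulVf n0) poweRrM -powR_mulrn ?(ltW (lt_trans _ s1))//.
rewrite -poweR_EFin; apply: gt0_ler_poweR; rewrite ?ler0n//.
- by rewrite in_itv/= poweR_ge0 leey.
- by rewrite in_itv/= lee_fin (ltW (lt_trans _ s1))//= leey.
apply: ltW; apply: le_lt_trans Vs; apply: ereal_sup_ubound.
by exists n => //; apply: NV; exact: ltnW.
Qed.

(** The growth rate to be allowed for rho when return probabilities decay like
r^m: with s^(n+1) = 1/r, a growth s^(n m) still leaves s^(n m) r^m = s^(-m). *)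
Lemma exists_root_gt1 (r : R) (n : nat) : 0 < r < 1 ->
  exists2 s : R, 1 < s & s ^+ n.+1 = r^-1.
Proof.
move=> /andP[r0 r1]; pose s := r^-1 `^ (n.+1%:R^-1).
have sr : s ^+ n.+1 = r^-1.
  by rewrite -powR_mulrn ?powR_ge0// -powRrM mulVf// powRr1// invr_ge0 ltW.
exists s => //; rewrite ltNge; apply/negP => s1.
have : s ^+ n.+1 <= 1 by rewrite exprn_ile1 ?powR_ge0.
by rewrite sr leNgt invf_gt1 ?r1.
Qed.

End Asymptotics.

Theorem corollary3 (R : realType) (G : groupType) (S : set G)
    (mu : G -> R) (g : G) :
  fin_sym_generating S -> fin_prob mu -> symmetric_measure mu ->
  (RD R S /\ superpoly_decay (return_prob mu g)) \/
    (SRD R S /\ exp_decay (return_prob mu g)) ->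
  forall tau : (l2 R G -> l2 R G) -> R[i],
    state tau -> stationary mu tau -> tau (@lambda R G g) = 0.
Proof.
move=> [_ _ gen] [_ fm _] sm decay tau st stat.
have [L0 mL0] := finite_in_ball gen fm; have [l gl] := gen g.
(* With L > 0 the radii L * 2n + l tend to infinity, even if mu = delta_1. *)
pose L := L0.+1.
have mL : [set t | mu t != 0] `<=` word_ball S L.
  by move=> t /mL0; exact: word_ballW.
have bound n M := @stationary_le R G S mu g tau fm sm st stat L l n M mL gl.
apply: Normc.eq0_normc; apply/eqP; rewrite -sqrf_eq0 eq_le sqr_ge0 andbT.
case: decay => [[[p pP] kd]|[srd [K [r [K0 r01 kK]]]]].
  (* With b the value of p at the radius, M = b^2 + 1 is a positive bound. *)
  pose q := ((p \Po (L%:R *: 'X + l%:R%:P)) ^+ 2 + 1) ^+ 2.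
  apply: (le0_of_cvg0 (superpoly_decay_horner q kd)); apply: nearW => n.
  rewrite /q !hornerE horner_comp !hornerE -natrM -natrD.
  set b := p.[_]; apply: bound; last by rewrite ltr_wpDl ?sqr_ge0.
  by apply: le_trans (pP _) _; rewrite lee_fin -/b; nra.
(* rho (L m + l) <= s^(L m + l) with s^(2L+1) = 1/r, so that
   rho (L m + l)^2 K r^m <= K s^(2l) s^(2L m) r^m = K s^(2l) s^(-m). *)
have [s s1 sr] := exists_root_gt1 (2 * L) r01.
have s0 : 0 < s by exact: lt_trans s1.
have sv : (fun m => (s ^+ (2 * l) * K) * s^-1 ^+ m) @ \oo --> (0 : R).
  rewrite -[X in _ --> X](mulr0 (s ^+ (2 * l) * K)); apply: cvgMl_tmp; apply: cvg_expr.
  by rewrite gtr0_norm ?invr_gt0// invf_lt1.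
apply: (le0_of_cvg0 sv).
have [N _ NP] := SRD_rho_le srd s1.
exists N => // n /= Nn.
have hn : (N <= L * n.*2 + l)%N.
  apply: leq_trans Nn _; apply: leq_trans (leq_addr _ _).
  by rewrite mulSn -addnn -addnA leq_addr.
apply: le_trans (bound n _ (NP _ hn) (exprn_gt0 _ s0)) _.
apply: le_trans (ler_wpM2l (sqr_ge0 _) (kK _)) _.
have -> : r = s^-1 ^+ (2 * L).+1 by rewrite exprVn sr invrK.
rewrite le_eqVlt; apply/orP; left; apply/eqP.
set m := n.*2.
have -> : s ^+ (L * m + l) ^+ 2 = s ^+ (2 * l) * s ^+ (2 * L * m).
  by rewrite -exprM -exprD; congr (_ ^+ _); ring.
rewrite -exprM [((2 * L).+1 * m)%N]mulSn exprD.
have : s ^+ (2 * L * m) * s^-1 ^+ (2 * L * m) = 1.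
  by rewrite -exprMn divff ?expr1n ?gt_eqF.
set x := s ^+ (2 * L * m); set y := _ ^+ (2 * L * m) => xy.
by rewrite -[RHS]mulr1 -xy; ring.
Qed.
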